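(* For all $n\ge2$, the map $\psi$ restricts to a bijection between the set of 1-terminal top-cycle-free chord diagrams of size $n$ and the set of noncrossing chord diagrams of size $n-1$.
   Context: A chord diagram of size $n$ is a perfect matching of $\{1,\dots,2n\}$; chords are ordered pairs $(a,b)$ with $a<b$, $a$ the source and $b$ the sink. A subset of chords is a subdiagram, viewed as a diagram by order-preserving relabelling of endpoints. For chords $c_1=(a_1,b_1)$, $c_2=(a_2,b_2)$ with $a_1<a_2$, they cross if $a_2<b_1<b_2$, and then $c_2$ is a right neighbor of $c_1$. A diagram is noncrossing if no two chords cross. A chord is terminal if it has no right neighbors. A diagram is 1-terminal if no chord other than the last one, in the order of sources, is terminal. For $m\ge3$ the top cycle diagram of size $m$ is $T_m=\{(2i-1,2i+2):1\le i\le m-1\}\cup\{(2,2m-1)\}$; a diagram is top-cycle-free if no subdiagram of it equals (after relabelling) some $T_m$, $m\ge3$. The map $\psi$ from 1-terminal diagrams of size $n$ to diagrams of size $n-1$ ($n\ge 2$): let $T$ be 1-terminal with chords $c_1<\dots<c_n$ ordered by source. The source-sink group of a chord $c$ consists of the source of $c$ together with the maximal run of consecutive sinks immediately following it (excluding the sink of $c$ itself). Then $\psi(T)$ is obtained from $T$ by (1) moving each source to the end of its source-sink group (all other endpoints keeping their relative order and every source staying paired with its sink), and (2) deleting the terminal chord $c_n$; endpoints are then relabelled order-preservingly. *)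

(* Defs.v *)
From mathcomp Require Import all_boot finmap.
From mathcomp Require Import boolp classical_sets functions.

Set Implicit Arguments.
Unset Strict Implicit.
Unset Printing Implicit Defensive.

Local Open Scope fset_scope.
Local Open Scope nat_scope.

(* [(a, b)] is the chord with source [a] and sink [b]. *)
Definition chord := (nat * nat)%type.

Definition sources (D : {fset chord}) : {fset nat} := [fset c.1 | c in D].
Definition sinks (D : {fset chord}) : {fset nat} := [fset c.2 | c in D].
Definition endpoints (D : {fset chord}) : {fset nat} := sources D `|` sinks D.

(* Perfect matchings of {1, ..., 2n}, with labels starting from 1. *)
Definition is_diagram (n : nat) (D : {fset chord}) : Prop :=
  (forall c, c \in D -> 1 <= c.1 /\ c.1 < c.2 /\ c.2 <= 2 * n) /\
  (forall x, 1 <= x <= 2 * n -> exists! c, c \in D /\ (c.1 = x \/ c.2 = x)).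

(* Order-preserving relabelling of the endpoints by 1, 2, 3, ... *)
Definition rank (E : {fset nat}) (x : nat) : nat := #|` [fset y in E | y <= x] |.
Definition relabel (D : {fset chord}) : {fset chord} :=
  [fset (rank (endpoints D) c.1, rank (endpoints D) c.2) | c in D].

Definition right_neighbor (c d : chord) : bool :=
  [&& c.1 < d.1, d.1 < c.2 & c.2 < d.2].
Definition cross (c d : chord) : bool := right_neighbor c d || right_neighbor d c.

Definition noncrossing (D : {fset chord}) : Prop :=
  forall c d, c \in D -> d \in D -> ~~ cross c d.

Definition terminal (D : {fset chord}) (c : chord) : Prop :=
  forall d, d \in D -> ~~ right_neighbor c d.

Definition is_last (D : {fset chord}) (c : chord) : bool :=
  (c \in D) && all (fun d => d.1 <= c.1) D.

Definition one_terminal (D : {fset chord}) : Prop :=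
  forall c, c \in D -> terminal D c -> is_last D c.

Definition top_cycle (m : nat) : {fset chord} :=
  [fset (2 * i - 1, 2 * i + 2) | i in iota 1 (m - 1)] `|` [fset (2, 2 * m - 1)].

Definition top_cycle_free (D : {fset chord}) : Prop :=
  forall (m : nat) (S : {fset chord}),
    3 <= m -> S `<=` D -> relabel S <> top_cycle m.

(* [x] joins the group of [c] when every position in the interval
   c.1 < y <= x is a sink, so that no source separates [x] from c.1. *)
Definition source_sink_group (D : {fset chord}) (c : chord) : {fset nat} :=
  c.1 |` [fset x in sinks D |
           [&& c.1 < x, x != c.2 & all (mem (sinks D)) (iota c.1.+1 (x - c.1))]].

(* Positions after every source has moved to the end of its group: the source
   takes the last position of the group, each sink of a group shifts left by
   one, and a sink lying in no group stays in place. *)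
Definition moved_source (D : {fset chord}) (c : chord) : nat :=
  \max_(x <- source_sink_group D c) x.
Definition moved_sink (D : {fset chord}) (c : chord) : nat :=
  if has (fun d => c.2 \in source_sink_group D d) D then c.2 - 1 else c.2.

(* Meaningful on 1-terminal diagrams only, where the groups are intervals and
   no source is moved past its own sink. *)
Definition psi (D : {fset chord}) : {fset chord} :=
  relabel [fset (moved_source D c, moved_sink D c) | c in D & ~~ is_last D c].

(* Main.v *)
(* Let (a_1, b_1), ..., (a_n, b_n) be the chords of T in the order of sources. Then T is
   1-terminal iff a_(i+1) < b_i for all i < n and b_n = 2n. In that case every position
   but 2n lies in exactly one source-sink group, so that psi sends T to the diagram
   {(a_(i+1) - 1, b_i - 1) : i < n}, and the relabelling is trivial. From a diagram D of
   size n - 1 one recovers T: the chord (s, t) comes from (s' + 1, t + 1), where s' is the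
   previous source (0 if s = 1), and the last chord is (s_max + 1, 2n). So psi is a
   bijection from all 1-terminal diagrams to all diagrams, and psi(T) has a crossing iff
   a_(j+1) < b_i < b_j for some i < j. The first two chords and the top chord of a top
   cycle give such i and j, and conversely c_i and c_j extend to a top cycle. *)
Require Import Defs.
From mathcomp Require Import all_boot finmap.
From mathcomp Require Import boolp classical_sets functions.
From mathcomp Require Import zify.

Section ChordDiagrams.

Local Set Implicit Arguments.
Local Unset Strict Implicit.
Local Open Scope fset_scope.
Local Open Scope nat_scope.

(* Simplification is needed because membership lemmas for [{fset chord}] type
   the projections of a chord over [Choice.sort _] instead of [nat]. *)
Local Ltac clia := simpl in *; lia.

Implicit Types (D T S : {fset chord}) (c d e : chord) (P : pred chord).

(** * Chords with extremal source; diagrams as perfect matchings *)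

Lemma exists_max_source D P c : c \in D -> P c ->
  exists e, [/\ e \in D, P e & forall d, d \in D -> P d -> d.1 <= e.1].
Proof.
move=> cD Pc; pose Q k := has (fun d => P d && (d.1 == k)) D.
have exQ : exists k, Q k by exists c.1; apply/hasP; exists c; rewrite ?Pc ?eqxx.
have ubQ k : Q k -> k <= \max_(d <- D) d.1.
  by case/hasP=> d dD /andP[_ /eqP<-];
    exact: (@leq_bigmax_seq _ _ xpredT (fun d : chord => d.1)).
case: (ex_maxnP exQ ubQ) => k /hasP[e eD /andP[Pe /eqP ek]] kmax.
exists e; split=> // d dD Pd; rewrite ek; apply: kmax.
by apply/hasP; exists d; rewrite ?Pd ?eqxx.
Qed.

Lemma exists_min_source D P c : c \in D -> P c ->
  exists e, [/\ e \in D, P e & forall d, d \in D -> P d -> e.1 <= d.1].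
Proof.
move=> cD Pc; pose Q k := has (fun d => P d && (d.1 == k)) D.
have exQ : exists k, Q k by exists c.1; apply/hasP; exists c; rewrite ?Pc ?eqxx.
case: (ex_minnP exQ) => k /hasP[e eD /andP[Pe /eqP ek]] kmin.
exists e; split=> // d dD Pd; rewrite ek; apply: kmin.
by apply/hasP; exists d; rewrite ?Pd ?eqxx.
Qed.

(** Splits the unique covering of positions into bounds, injectivity, disjointness and covering. *)
Lemma is_diagramP n D :
  is_diagram n D <->
  [/\ forall c, c \in D -> 1 <= c.1 /\ c.1 < c.2 <= 2 * n,
      forall c d, c \in D -> d \in D -> c.1 = d.1 -> c = d,
      forall c d, c \in D -> d \in D -> c.2 = d.2 -> c = d,
      forall c d, c \in D -> d \in D -> c.1 <> d.2 &
      forall x, 1 <= x <= 2 * n -> exists2 c, c \in D & c.1 = x \/ c.2 = x].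
Proof.
split=> [[bnd uni]|[bnd inj1 inj2 disj cov]]; last first.
  split=> [c /bnd[? /andP[]]//|x /cov[c cD cx]]; exists c; split=> // d [dD dx].
  case: cx dx => <- [] => [dc|dc|dc|dc]; [exact: inj1| |  |exact: inj2].
    by case: (disj c d cD dD).
  by case: (disj d c dD cD).
have bnd' c : c \in D -> 1 <= c.1 /\ c.1 < c.2 <= 2 * n.
  by move=> /bnd[? [? ?]]; split=> //; apply/andP.
have uniq x c d : c \in D -> d \in D -> 1 <= x <= 2 * n ->
  (c.1 = x \/ c.2 = x) -> (d.1 = x \/ d.2 = x) -> c = d.
  by move=> cD dD /uni[e [_ ue]] cx dx; rewrite -(ue c) ?(ue d).
split=> [//|c d cD dD cd|c d cD dD cd|c d cD dD cd|x /uni[c [[cD cx] _]]].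
- by apply: (uniq c.1); rewrite -?cd; auto; have := bnd' _ cD; lia.
- by apply: (uniq c.2); rewrite -?cd; auto; have := bnd' _ cD; lia.
- have E : c = d by apply: (uniq c.1); rewrite -?cd; auto; have := bnd' _ cD; lia.
  by have := bnd' _ cD; rewrite -E in cd; lia.
- by exists c.
Qed.

Section Diagram.
Variables (n : nat) (D : {fset chord}).
Hypothesis Dn : is_diagram n D.

Lemma diagram_bound c : c \in D -> 1 <= c.1 /\ c.1 < c.2 <= 2 * n.
Proof. by move: c; case/is_diagramP: Dn. Qed.

Lemma diagram_source_inj c d : c \in D -> d \in D -> c.1 = d.1 -> c = d.
Proof. by move: c d; case/is_diagramP: Dn. Qed.

Lemma diagram_sink_inj c d : c \in D -> d \in D -> c.2 = d.2 -> c = d.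
Proof. by move: c d; case/is_diagramP: Dn. Qed.

Lemma diagram_source_neq_sink c d : c \in D -> d \in D -> c.1 <> d.2.
Proof. by move: c d; case/is_diagramP: Dn. Qed.

Lemma diagram_cover x : 1 <= x <= 2 * n -> exists2 c, c \in D & c.1 = x \/ c.2 = x.
Proof. by move: x; case/is_diagramP: Dn. Qed.

End Diagram.

(** The chord of [D] covering [c.1] also lies in [T], hence equals [c]. So one inclusion suffices in
    both inversion proofs below. *)
Lemma diagram_sub_eq n D T : is_diagram n D -> is_diagram n T -> D `<=` T -> D = T.
Proof.
move=> Dn Tn /fsubsetP DT; apply/fsetP=> c; apply/idP/idP=> [/DT//|cT].
have cb := diagram_bound Tn cT.
have [|d dD dc] := diagram_cover Dn (x := c.1); first by clia.
case: dc => dc; first by rewrite -(diagram_source_inj Tn (DT _ dD) cT dc).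
by have := diagram_source_neq_sink Tn cT (DT _ dD) (esym dc).
Qed.

(** * Ranks and relabelling *)

Lemma rank_mono (E : {fset nat}) x y : x <= y -> rank E x <= rank E y.
Proof.
move=> xy; apply: fsubset_leq_card; apply/fsubsetP=> z.
by rewrite !inE /= => /andP[-> /leq_trans->].
Qed.

Lemma rank_lt (E : {fset nat}) x y : rank E x < rank E y -> x < y.
Proof. by apply: contraTT; rewrite -!leqNgt; apply: rank_mono. Qed.

(** The endpoints of the image are exactly [f 1 < ... < f (2n)], so [f x] has rank [x]. This serves
    both to drop the relabelling in [psi] and to recognise an embedded top cycle. *)
Lemma relabel_increasing n D (f : nat -> nat) : is_diagram n D ->
  (forall x y, 1 <= x -> x < y -> y <= 2 * n -> f x < f y) ->
  relabel [fset (f c.1, f c.2) | c in D] = D.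
Proof.
move=> Dn fmono; set S := [fset _ | _ in _].
have leq_f x y : 1 <= x <= 2 * n -> 1 <= y <= 2 * n -> (f x <= f y) = (x <= y).
  move=> xn yn; case: (ltngtP x y) => [xy|yx|->]; last by rewrite leqnn.
  - by apply: ltnW; apply: fmono; lia.
  - by apply: negbTE; rewrite -ltnNge; apply: fmono; lia.
have endS y : (y \in endpoints S) = (y \in [fset f x | x in iota 1 (2 * n)]).
  apply/idP/imfsetP => [|[x /= ]].
    case/fsetUP=> /imfsetP[_ /imfsetP[c /= cD ->] ->] /=; have := diagram_bound Dn cD.
      by exists c.1 => //=; rewrite mem_iota; lia.
    by exists c.2 => //=; rewrite mem_iota; lia.
  rewrite mem_iota => xn ->.
  have [|c cD [] <-] := diagram_cover Dn (x := x); first by clia.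
    apply/fsetUP; left; apply/imfsetP; exists (f c.1, f c.2) => //=.
    by apply/imfsetP; exists c.
  apply/fsetUP; right; apply/imfsetP; exists (f c.1, f c.2) => //=.
  by apply/imfsetP; exists c.
have rankf x : 1 <= x <= 2 * n -> rank (endpoints S) (f x) = x.
  move=> xn; rewrite /rank.
  have -> : [fset y in endpoints S | y <= f x] = [fset f z | z in iota 1 x].
    apply/fsetP=> y; rewrite in_fset inE /= endS; apply/andP/imfsetP => /=.
      case=> /imfsetP[z /= + ->]; rewrite mem_iota => zn; rewrite leq_f; [|lia|lia].
      by move=> zx; exists z => //; rewrite mem_iota; lia.
    case=> z; rewrite mem_iota => zx ->; split; last by rewrite leq_f; lia.
    by apply/imfsetP; exists z => //=; rewrite mem_iota; lia.
  rewrite card_in_imfset /=; last first.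
    move=> y z; rewrite !mem_iota => yx zx fyz.
    by apply/eqP; rewrite eqn_leq -(leq_f y z) -?(leq_f z y) ?fyz ?leqnn //; lia.
  by rewrite undup_id ?iota_uniq // size_iota.
have rankc c : c \in D -> (rank (endpoints S) (f c.1), rank (endpoints S) (f c.2)) = c.
  move=> cD; have cb := diagram_bound Dn cD.
  by rewrite !rankf; [case: (c) | lia | lia].
apply/fsetP=> c; apply/imfsetP/idP => [[_ /imfsetP[d /= dD ->] ->]|cD].
  by rewrite rankc.
by exists (f c.1, f c.2); [apply/imfsetP; exists c | rewrite rankc].
Qed.

Lemma relabel_diagram n D : is_diagram n D -> relabel D = D.
Proof.
move=> Dn; rewrite -[RHS](relabel_increasing Dn (f := id)) //; congr relabel.
apply/fsetP=> c; apply/idP/imfsetP => [cD|[d /= dD ->]]; last by case: (d) dD.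
by exists c => //; case: (c).
Qed.

(** * One-terminal diagrams *)

(** Stands for the pair [c_i], [c_(i+1)] without enumerating the chords. *)
Definition consecutive T c d : Prop :=
  [/\ c \in T, d \in T, c.1 < d.1 & forall e, e \in T -> c.1 < e.1 -> d.1 <= e.1].

Lemma is_lastP T c :
  is_last T c <-> c \in T /\ forall d, d \in T -> d.1 <= c.1.
Proof.
split=> [/andP[cT /allP cmax]|[cT cmax]]; first by split.
by apply/andP; split=> //; apply/allP.
Qed.

Lemma exists_last T c : c \in T -> exists d, is_last T d.
Proof.
move=> cT; have [//|d [dT _ dmax]] := @exists_max_source T xpredT c cT.
by exists d; apply/is_lastP; split=> // e /dmax ->.
Qed.

Lemma exists_next T c d : c \in T -> d \in T -> c.1 < d.1 ->
  exists e, consecutive T c e.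
Proof.
move=> cT dT cd.
have [e [eT ce emin]] := @exists_min_source T (fun e => c.1 < e.1) d dT cd.
by exists e; split.
Qed.

Lemma consecutive_not_last T c d : consecutive T c d -> ~~ is_last T c.
Proof. by case=> cT dT cd _; apply/negP=> /is_lastP[_ /(_ d dT)]; lia. Qed.

Lemma exists_next_not_last T c : c \in T -> ~~ is_last T c ->
  exists d, consecutive T c d.
Proof.
move=> cT; rewrite /is_last cT /= => /allPn[d dT]; rewrite -ltnNge.
exact: exists_next.
Qed.

Lemma exists_previous n T d : is_diagram n T -> d \in T -> 1 < d.1 ->
  exists c, consecutive T c d.
Proof.
move=> Tn dT d1; have db := diagram_bound Tn dT.
have [|c0 c0T c0E] := diagram_cover Tn (x := 1); first by clia.
have c01 : c0.1 = 1 by have := diagram_bound Tn c0T; clia.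
have [|c [cT cd cmax]] := @exists_max_source T (fun c => c.1 < d.1) c0 c0T.
  by rewrite c01.
by exists c; split=> // e eT; rewrite ltnNge; apply: contraNT; rewrite -ltnNge; exact: cmax.
Qed.

(* Writing the chords as [(a_i, b_i)] in the order of sources, this says that
   [a_(i+1) < b_i] for [i < n] and [b_n = 2n]. *)
Definition staggered n T : Prop :=
  (forall c d, consecutive T c d -> d.1 < c.2) /\
  (forall c, is_last T c -> c.2 = 2 * n).

Lemma sink_max_last n T c : is_diagram n T -> staggered n T ->
  c \in T -> (c.2 == 2 * n) = is_last T c.
Proof.
move=> Tn [_ lastT] cT; apply/eqP/idP=> [c2|/lastT//].
have [d dl] := exists_last cT; have /is_lastP[dT _] := dl.
by rewrite (diagram_sink_inj Tn cT dT) // c2 lastT.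
Qed.

(* The chord with the last source before the sink of [c] ends after [c]: it
   reaches the next source, or it is the last chord. *)
Lemma exists_farthest_right_neighbor n T c :
  is_diagram n T -> staggered n T -> c \in T -> c.2 < 2 * n ->
  exists e, [/\ e \in T, right_neighbor c e &
    forall d, d \in T -> d.1 < c.2 -> d.1 <= e.1].
Proof.
move=> Tn Ts cT c2; have := sink_max_last Tn Ts cT.
rewrite ltn_eqF // => /esym/negbT cl; have [nextT lastT] := Ts.
have [d cd] := exists_next_not_last cT cl; have := nextT _ _ cd.
case: cd => _ dT cd _ dc.
have [e [eT ec emax]] := @exists_max_source T (fun e => e.1 < c.2) d dT dc.
exists e; split=> //; have de := emax _ dT dc.
apply/and3P; split=> //; first exact: leq_trans de.
have [/lastT->//|el] := boolP (is_last T e).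
have [f ef] := exists_next_not_last eT el; have := nextT _ _ ef.
case: ef => _ fT ef _ fe; apply: leq_ltn_trans fe.
by rewrite leqNgt; apply/negP=> /emax-/(_ fT); lia.
Qed.

(** If the next source is beyond the sink of [c], no source lies inside [c], so [c] is terminal but
    not last. The chord ending at [2n] is terminal, hence last. Conversely, a chord ending before
    [2n] has a right neighbor. *)
Lemma one_terminalP n T : is_diagram n T -> one_terminal T <-> staggered n T.
Proof.
move=> Tn; split=> [T1|Ts c cT]; last first.
  rewrite -(sink_max_last Tn Ts cT); have cb := diagram_bound Tn cT.
  have [//|c2 ct] := eqVneq c.2 (2 * n).
  have [|e [eT ce _]] := exists_farthest_right_neighbor Tn Ts cT; first by clia.
  by move: (ct e eT); rewrite ce.
split=> [c d cd|c /is_lastP[cT cmax]].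
  have cl := consecutive_not_last cd; case: cd => cT dT cd dmin.
  apply: contraNT cl; rewrite -leqNgt => dc; apply: T1 => // e eT.
  by apply/and3P=> -[ce ec _]; have := dmin _ eT ce; clia.
have cb := diagram_bound Tn cT.
have [|d dT d2] := diagram_cover Tn (x := 2 * n); first by clia.
have db := diagram_bound Tn dT.
have d2' : d.2 = 2 * n by clia.
have /is_lastP[_ dmax] : is_last T d.
  apply: T1 => // e eT; apply/and3P=> -[_ _].
  by have := diagram_bound Tn eT; clia.
rewrite -d2'; congr snd; apply: (diagram_source_inj Tn) => //.
by have := cmax _ dT; have := dmax _ cT; clia.
Qed.

(** * The map psi *)

Definition psi_unlabelled T : {fset chord} :=
  [fset (moved_source T c, moved_sink T c) | c in T & ~~ is_last T c].

Lemma mem_group T c x : x \in source_sink_group T c ->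
  x = c.1 \/ [/\ c.1 < x, x != c.2 & forall y, c.1 < y <= x -> y \in sinks T].
Proof.
rewrite /source_sink_group in_fset1U => /orP[/eqP|]; first by left.
rewrite !inE /= => /and4P[_ cx xc /allP sx]; right; split=> // y cy.
by apply: sx; rewrite mem_iota; clia.
Qed.

Lemma group_mem T c x : c.1 < x -> x != c.2 ->
  (forall y, c.1 < y <= x -> y \in sinks T) -> x \in source_sink_group T c.
Proof.
move=> cx xc sx; rewrite /source_sink_group in_fset1U; apply/orP; right.
rewrite !inE /=; apply/and4P; split=> //; first by apply: sx; rewrite cx /=.
by apply/allP=> y; rewrite mem_iota => cy; apply: sx; clia.
Qed.

Lemma mem_sinks n T x : is_diagram n T -> 1 <= x <= 2 * n ->
  (forall e, e \in T -> e.1 != x) -> x \in sinks T.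
Proof.
move=> Tn xn nsx; have [e eT [ex|<-]] := diagram_cover Tn xn; last exact: in_imfset.
by case/eqP: (nsx _ eT).
Qed.

(** All positions strictly between [c.1] and [d.1] are sinks, none of them [c.2], so the group of
    [c] is the interval from [c.1] to [d.1 - 1]. *)
Lemma moved_source_consecutive n T c d : is_diagram n T ->
  consecutive T c d -> d.1 < c.2 -> moved_source T c = d.1 - 1.
Proof.
move=> Tn [cT dT cd dmin] dc; apply/eqP; rewrite eqn_leq; apply/andP; split.
  apply/bigmax_leqP_seq=> x /mem_group + _; case=> [->|[cx _ sx]]; first by clia.
  suff : ~~ (d.1 <= x) by clia.
  apply/negP=> dx; have /sx/imfsetP[e /= eT de] : c.1 < d.1 <= x by rewrite cd.
  by case: (diagram_source_neq_sink Tn dT eT).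
have [dc1|dc1] := eqVneq (d.1 - 1) c.1.
  by apply: (@leq_bigmax_seq _ _ xpredT id) => //; rewrite dc1 fset1U1.
apply: (@leq_bigmax_seq _ _ xpredT id) => //; apply: group_mem; [clia|clia|].
have cb := diagram_bound Tn cT; move=> y cy.
apply: (mem_sinks Tn) => [|e eT]; first by clia.
by apply/eqP=> ey; have := dmin _ eT; clia.
Qed.

(** The sink of [c] lies in the group of the chord [e] with the last source before [c.2]; [e]
    differs from [c] because [d] also starts before [c.2]. *)
Lemma moved_sink_consecutive n T c d : is_diagram n T ->
  consecutive T c d -> d.1 < c.2 -> moved_sink T c = c.2 - 1.
Proof.
move=> Tn [cT dT cd dmin] dc; rewrite /moved_sink ifT //; apply/hasP.
have [e [eT ec emax]] := @exists_max_source T (fun e => e.1 < c.2) d dT dc.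
exists e => //; apply: group_mem => //.
  apply/eqP=> /(diagram_sink_inj Tn cT eT) ce.
  by have := emax _ dT dc; rewrite -ce; clia.
have cb := diagram_bound Tn cT; move=> y ey.
apply: (mem_sinks Tn) => [|f fT]; first by clia.
apply/eqP=> fy; have [fc|fc] := ltnP f.1 c.2; first by have := emax _ fT fc; clia.
by apply: (diagram_source_neq_sink Tn fT cT); clia.
Qed.

Lemma psi_unlabelledP n T x : is_diagram n T -> staggered n T ->
  x \in psi_unlabelled T <->
  exists c d, consecutive T c d /\ x = (d.1 - 1, c.2 - 1).
Proof.
move=> Tn [nextT lastT]; split.
  case/imfsetP=> c /andP[/= cT cl] ->; have [d cd] := exists_next_not_last cT cl.
  have dc := nextT _ _ cd; exists c, d; split=> //.
  by rewrite (moved_source_consecutive Tn cd dc) (moved_sink_consecutive Tn cd dc).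
move=> [c [d [cd ->]]]; have dc := nextT _ _ cd; apply/imfsetP; exists c.
  by rewrite /= inE /= (consecutive_not_last cd) andbT; case: cd.
by rewrite (moved_source_consecutive Tn cd dc) (moved_sink_consecutive Tn cd dc).
Qed.

Lemma consecutive_fun n T c d d' : is_diagram n T ->
  consecutive T c d -> consecutive T c d' -> d = d'.
Proof.
move=> Tn [cT dT cd dmin] [_ d'T cd' d'min]; apply: (diagram_source_inj Tn) => //.
by have := dmin _ d'T cd'; have := d'min _ dT cd; clia.
Qed.

Lemma consecutive_inj n T c c' d : is_diagram n T ->
  consecutive T c d -> consecutive T c' d -> c = c'.
Proof.
move=> Tn [cT dT cd dmin] [c'T _ c'd d'min]; apply: (diagram_source_inj Tn) => //.
by have := dmin _ c'T; have := d'min _ cT; clia.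
Qed.

(** Only the first source, 1, and the last sink, [2n], disappear; the positions from 2 to [2n - 1]
    shift down by one. *)
Lemma psi_unlabelled_diagram n T : 0 < n -> is_diagram n T -> staggered n T ->
  is_diagram (n - 1) (psi_unlabelled T).
Proof.
move=> n0 Tn Ts; have mem := psi_unlabelledP _ Tn Ts; have [nextT lastT] := Ts.
apply/is_diagramP; split.
- move=> _ /mem[c [d [cd ->]]] /=; have := consecutive_not_last cd.
  have := nextT _ _ cd; case: cd => cT dT cd _ dc.
  have := diagram_bound Tn cT; rewrite -(sink_max_last Tn Ts cT).
  by clia.
- move=> _ _ /mem[c [d [cd ->]]] /mem[c' [d' [cd' ->]]] /= dd'.
  have E : d = d'.
    by case: cd cd' => _ dT cd _ [_ d'T cd' _]; apply: (diagram_source_inj Tn) => //; clia.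
  by rewrite -E in cd' *; rewrite (consecutive_inj Tn cd cd').
- move=> _ _ /mem[c [d [cd ->]]] /mem[c' [d' [cd' ->]]] /= cc'.
  have E : c = c'.
    have dc := nextT _ _ cd; have dc' := nextT _ _ cd'.
    by case: cd cd' => cT _ cd _ [c'T _ cd' _]; apply: (diagram_sink_inj Tn) => //; clia.
  by rewrite -E in cd' *; rewrite (consecutive_fun Tn cd cd').
- move=> _ _ /mem[c [d [cd ->]]] /mem[c' [d' [cd' ->]]] /=.
  have dc := nextT _ _ cd; have dc' := nextT _ _ cd'.
  case: cd cd' => cT dT cd _ [c'T d'T cd' _].
  by have := diagram_source_neq_sink Tn dT c'T; clia.
move=> x xn; have [|c cT cx] := diagram_cover Tn (x := x.+1); first by clia.
case: cx => cx.
  have [|b bc] := exists_previous Tn cT; first by clia.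
  exists (c.1 - 1, b.2 - 1); last by left; rewrite /= cx; lia.
  by apply/mem; exists b, c.
have cl : ~~ is_last T c by rewrite -(sink_max_last Tn Ts cT); clia.
have [d cd] := exists_next_not_last cT cl.
exists (d.1 - 1, c.2 - 1); last by right; rewrite /= cx; lia.
by apply/mem; exists c, d.
Qed.

Lemma psiE n T : 0 < n -> is_diagram n T -> staggered n T -> psi T = psi_unlabelled T.
Proof. by move=> n0 Tn Ts; apply: (relabel_diagram (psi_unlabelled_diagram n0 Tn Ts)). Qed.

Lemma psi_diagram n T : 0 < n -> is_diagram n T -> staggered n T ->
  is_diagram (n - 1) (psi T).
Proof. by move=> n0 Tn Ts; rewrite (psiE n0 Tn Ts); exact: psi_unlabelled_diagram. Qed.

Lemma mem_psi n T x : 0 < n -> is_diagram n T -> staggered n T ->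
  x \in psi T <-> exists c d, consecutive T c d /\ x = (d.1 - 1, c.2 - 1).
Proof. by move=> n0 Tn Ts; rewrite (psiE n0 Tn Ts); exact: (psi_unlabelledP _ Tn Ts). Qed.

(** * The inverse of psi *)

(** The empty maximum gives 0, which leads to the source 1 of the first chord of the preimage. *)
Definition previous_source D x : nat := \max_(c <- D | c.1 < x) c.1.

Lemma previous_sourceP n D x : is_diagram n D ->
  (forall c, c \in D -> c.1 < x -> c.1 <= previous_source D x) /\
  (previous_source D x = 0 \/ exists2 c, c \in D & c.1 = previous_source D x /\ c.1 < x).
Proof.
move=> Dn; split=> [c cD cx|].
  exact: (@leq_bigmax_seq _ _ (fun d : chord => d.1 < x) (fun d : chord => d.1)).
have [/hasP[c cD cx]|/hasPn none] := boolP (has (fun c : chord => c.1 < x) D); [right|left].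
  have [e [eD ex emax]] := @exists_max_source D (fun e => e.1 < x) c cD cx.
  exists e => //; split=> //; apply/eqP; rewrite eqn_leq; apply/andP; split.
    exact: (@leq_bigmax_seq _ _ (fun d : chord => d.1 < x) (fun d : chord => d.1)).
  by apply/bigmax_leqP_seq => d; exact: emax.
apply/eqP; rewrite -leqn0; apply/bigmax_leqP_seq => d /none.
by move=> /negP.
Qed.

Lemma previous_source_lt n D x : is_diagram n D -> 0 < x -> previous_source D x < x.
Proof. by move=> Dn x0; have [_ [->|[c _ []]]] := previous_sourceP x Dn; clia. Qed.

(* The last chord of the preimage comes from the pseudo-chord [(2n, 2n - 1)], whose
   source is beyond all those of [D]. *)
Definition extended n D : {fset chord} := (2 * n, 2 * n - 1) |` D.

(** In [psi T], the source before [a_(i+1) - 1] is [a_i - 1], or the default 0 if [i = 1]; adding 1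
    restores [(a_i, b_i)]. *)
Definition psi_inv n D : {fset chord} :=
  [fset (previous_source D c.1 + 1, c.2 + 1) | c in extended n D].

Section Inverse.
Variables (n : nat) (D : {fset chord}).
Hypotheses (n0 : 0 < n) (Dn : is_diagram (n - 1) D).

Lemma extendedP c : c \in extended n D <-> c = (2 * n, 2 * n - 1) \/ c \in D.
Proof.
rewrite in_fset1U; split=> [/orP[/eqP|]|[->|->]]; rewrite ?eqxx ?orbT; by [left|right|].
Qed.

Lemma psi_invP x : x \in psi_inv n D <->
  exists2 c, c \in extended n D & x = (previous_source D c.1 + 1, c.2 + 1).
Proof. by split=> [/imfsetP[c cE ->]|[c cE ->]]; [exists c | apply/imfsetP; exists c]. Qed.

(** Here [c] is not the pseudo-chord, so [c.1] is a source of [D] lying above its own previous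
    source and at most that of [d.1]. *)
Lemma previous_source_mono c d : c \in extended n D -> d \in extended n D ->
  c.1 < d.1 -> previous_source D c.1 < previous_source D d.1.
Proof.
move=> /extendedP[->|cD] /extendedP[->|dD] /= cd; try lia.
- by have := diagram_bound Dn dD; clia.
- apply: (@leq_trans c.1); last by have [+ _] := previous_sourceP (2 * n) Dn; apply.
  by apply: (previous_source_lt Dn); have := diagram_bound Dn cD; clia.
- apply: (@leq_trans c.1); last by have [+ _] := previous_sourceP d.1 Dn; apply.
  by apply: (previous_source_lt Dn); have := diagram_bound Dn cD; clia.
Qed.

Lemma previous_source_lt_inv c d : c \in extended n D -> d \in extended n D ->
  previous_source D c.1 < previous_source D d.1 -> c.1 < d.1.
Proof.
move=> cE dE; case: (ltngtP c.1 d.1) => [//|dc|->]; last by rewrite ltnn.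
by have := previous_source_mono dE cE dc; clia.
Qed.

Lemma extended_bound c : c \in extended n D -> 1 <= c.1 <= 2 * n /\ 1 <= c.2 < 2 * n.
Proof. by case/extendedP=> [->|/(diagram_bound Dn)] /=; clia. Qed.

Lemma extended_source_inj c d : c \in extended n D -> d \in extended n D ->
  c.1 = d.1 -> c = d.
Proof.
move=> /extendedP[->|cD] /extendedP[->|dD] //= cd.
- by have := diagram_bound Dn dD; clia.
- by have := diagram_bound Dn cD; clia.
- exact: (diagram_source_inj Dn).
Qed.

Lemma extended_sink_inj c d : c \in extended n D -> d \in extended n D ->
  c.2 = d.2 -> c = d.
Proof.
move=> /extendedP[->|cD] /extendedP[->|dD] //= cd.
- by have := diagram_bound Dn dD; clia.
- by have := diagram_bound Dn cD; clia.
- exact: (diagram_sink_inj Dn).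
Qed.

Lemma psi_inv_source_inj c d : c \in extended n D -> d \in extended n D ->
  previous_source D c.1 = previous_source D d.1 -> c = d.
Proof.
move=> cE dE cd; apply: extended_source_inj => //.
case: (ltngtP c.1 d.1) => // [/(previous_source_mono cE dE)|/(previous_source_mono dE cE)].
  by rewrite cd ltnn.
by rewrite cd ltnn.
Qed.

(** Take the smallest source of [extended n D] beyond [x]; the pseudo-chord ensures that there is
    one. *)
Lemma previous_source_surj x : x = 0 \/ (exists2 c, c \in D & c.1 = x) ->
  exists2 d, d \in extended n D & previous_source D d.1 = x.
Proof.
move=> xs; have lastE : (2 * n, 2 * n - 1) \in extended n D by apply/extendedP; left.
have x2n : x < 2 * n by case: xs => [->|[c cD <-]]; [lia|have := diagram_bound Dn cD; clia].
have [d [dE xd dmin]] := @exists_min_source _ (fun d => x < d.1) _ lastE x2n.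
exists d => //; have [pmax pP] := previous_sourceP d.1 Dn.
apply/eqP; rewrite eqn_leq; apply/andP; split.
  case: pP => [->//|[e eD [<- ed]]]; rewrite leqNgt; apply/negP=> xe.
  have eE : e \in extended n D by apply/extendedP; right.
  by have := dmin _ eE xe; clia.
by case: xs xd => [->//|[c cD <-]]; exact: pmax.
Qed.

Lemma psi_inv_diagram : is_diagram n (psi_inv n D).
Proof.
apply/is_diagramP; split.
- move=> _ /psi_invP[c cE ->] /=.
  have cb := extended_bound cE; have c0 : 0 < c.1 by clia.
  have pc := previous_source_lt Dn c0.
  case/extendedP: cE pc => [->|cD] /=; last by have := diagram_bound Dn cD; clia.
  have [_ [->|[d dD [<- _]]]] := previous_sourceP (2 * n) Dn; first by clia.
  by have := diagram_bound Dn dD; clia.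
- move=> _ _ /psi_invP[c cE ->] /psi_invP[d dE ->] /= cd.
  by rewrite (psi_inv_source_inj cE dE) //; lia.
- move=> _ _ /psi_invP[c cE ->] /psi_invP[d dE ->] /= cd.
  by rewrite (extended_sink_inj cE dE) //; clia.
- move=> _ _ /psi_invP[c cE ->] /psi_invP[d dE ->] /= cd.
  have db := extended_bound dE.
  have [_ [|[e eD [ec _]]]] := previous_sourceP c.1 Dn; first by clia.
  case/extendedP: dE cd db => [->|dD] /= cd _; first by have := diagram_bound Dn eD; clia.
  by apply: (diagram_source_neq_sink Dn eD dD); clia.
move=> x xn.
have sourceC y : y = 0 \/ (exists2 c, c \in D & c.1 = y) -> y + 1 = x ->
    exists2 c, c \in psi_inv n D & c.1 = x \/ c.2 = x.
  move=> /previous_source_surj[d dE dy] yx.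
  exists (previous_source D d.1 + 1, d.2 + 1); last by left; rewrite /= dy.
  by apply/psi_invP; exists d.
have sinkC c : c \in extended n D -> c.2 + 1 = x ->
    exists2 c, c \in psi_inv n D & c.1 = x \/ c.2 = x.
  move=> cE cx; exists (previous_source D c.1 + 1, c.2 + 1); last by right.
  by apply/psi_invP; exists c.
(* Position 1 comes from the default 0, position [2n] from the pseudo-chord, and any other [x] from
   position [x - 1] of [D]. *)
have [x1|x1] := eqVneq x 1; first by apply: (sourceC 0); [left | rewrite x1].
have [x2n|x2n] := eqVneq x (2 * n).
  by apply: (sinkC (2 * n, 2 * n - 1)); [apply/extendedP; left | rewrite /=; lia].
have [|c cD [cx|cx]] := diagram_cover Dn (x := x - 1); first by clia.
  by apply: (sourceC c.1); [right; exists c | clia].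
by apply: (sinkC c); [apply/extendedP; right | clia].
Qed.

(** The next chord comes from the one whose previous source is [c.1]. *)
Lemma psi_inv_consecutive c : c \in D ->
  exists2 d, consecutive (psi_inv n D) (previous_source D c.1 + 1, c.2 + 1) d &
    d.1 = c.1 + 1.
Proof.
move=> cD; have [|d dE dc] := @previous_source_surj c.1; first by right; exists c.
have cE : c \in extended n D by apply/extendedP; right.
have c0 : 0 < c.1 by have := diagram_bound Dn cD; clia.
have pc := previous_source_lt Dn c0.
exists (previous_source D d.1 + 1, d.2 + 1); last by rewrite /= dc.
split; [by apply/psi_invP; exists c | by apply/psi_invP; exists d | by rewrite /= dc; lia |].
move=> _ /psi_invP[e eE ->] /= ce.
have {}ce : c.1 < e.1 by apply: previous_source_lt_inv => //; lia.
by rewrite dc leq_add2r; have [+ _] := previous_sourceP e.1 Dn; apply.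
Qed.

(** The source after the image of [c] is at most [c.1 + 1], below its sink [c.2 + 1]; the last chord
    comes from the pseudo-chord. *)
Lemma psi_inv_staggered : staggered n (psi_inv n D).
Proof.
split=> [_ d [/psi_invP[c cE ->] /psi_invP[e eE ->] /= ce dmin]|].
  have {}ce : c.1 < e.1 by apply: previous_source_lt_inv => //; lia.
  case/extendedP: cE => [cl|cD].
    by have := extended_bound eE; rewrite cl /= in ce *; clia.
  have [f [_ fE cf _] fc] := psi_inv_consecutive cD.
  by have := dmin _ fE cf; have := diagram_bound Dn cD; clia.
move=> _ /is_lastP[/psi_invP[c cE ->] cmax] /=.
have lastE : (2 * n, 2 * n - 1) \in extended n D by apply/extendedP; left.
have [->|cD] := (extendedP c).1 cE; first by rewrite /=; lia.
have cl : c.1 < 2 * n by have := diagram_bound Dn cD; clia.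
have := previous_source_mono cE lastE cl.
have /cmax /= : (previous_source D (2 * n) + 1, 2 * n - 1 + 1) \in psi_inv n D.
  by apply/psi_invP; exists (2 * n, 2 * n - 1).
by clia.
Qed.

Lemma psi_invK : psi (psi_inv n D) = D.
Proof.
apply/esym/(diagram_sub_eq Dn).
  exact: (psi_diagram n0 psi_inv_diagram psi_inv_staggered).
apply/fsubsetP=> c cD; apply/(mem_psi _ n0 psi_inv_diagram psi_inv_staggered).
have [d cd dc] := psi_inv_consecutive cD.
exists (previous_source D c.1 + 1, c.2 + 1), d; split=> //.
by rewrite dc /= !addnK; case: (c).
Qed.

End Inverse.

Lemma psiK n T : 0 < n -> is_diagram n T -> staggered n T -> psi_inv n (psi T) = T.
Proof.
move=> n0 Tn Ts; have Dn := psi_diagram n0 Tn Ts; have mem := mem_psi _ n0 Tn Ts.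
apply/esym/(diagram_sub_eq Tn (psi_inv_diagram n0 Dn))/fsubsetP=> c cT.
(* If [c] has the largest source of [T] up to [y], then [c.1 - 1] is the previous source in [psi T],
   whose sources are those of [T] beyond 1, lowered by one. It is applied with [y = 2n] for the last
   chord and [y = d.1 - 1] otherwise. *)
have prevE y : (forall e, e \in T -> e.1 < y + 1 -> e.1 <= c.1) -> c.1 < y + 1 ->
    previous_source (psi T) y + 1 = c.1.
  move=> cmax cy; have cb := diagram_bound Tn cT; have [pmax pP] := previous_sourceP y Dn.
  have ub : previous_source (psi T) y + 1 <= c.1.
    case: pP => [->|[e /mem[a [b [[_ bT ab _] ->]]] /= [<- by1]]]; first by clia.
    by have := cmax b bT; clia.
  suff : c.1 <= previous_source (psi T) y + 1 by clia.
  have [c1|c1] := leqP c.1 1; first by clia.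
  have [b bc] := exists_previous Tn cT c1.
  have /pmax /= : (c.1 - 1, b.2 - 1) \in psi T by apply/mem; exists b, c.
  by clia.
apply/psi_invP; have [cl|cl] := boolP (is_last T c).
  exists (2 * n, 2 * n - 1); first by apply/extendedP; left.
  have c2 := Ts.2 _ cl; have cb := diagram_bound Tn cT.
  rewrite /= prevE; [|by case/is_lastP: cl => _ cmax e eT _; exact: cmax|by clia].
  by rewrite subnK ?muln_gt0 // -c2; case: (c).
have [d cd] := exists_next_not_last cT cl.
exists (d.1 - 1, c.2 - 1); first by apply/extendedP; right; apply/mem; exists c, d.
have cb := diagram_bound Tn cT; have [_ dT lt_cd dmin] := cd.
rewrite /= prevE; [|by move=> e eT ed; rewrite leqNgt; apply/negP=> /(dmin _ eT); clia|by clia].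
by rewrite subnK; [case: (c)|clia].
Qed.

(** * Top cycles and crossings *)

Lemma top_cycleP m c : c \in top_cycle m <->
  (exists2 i, 1 <= i < m & c = (2 * i - 1, 2 * i + 2)) \/ c = (2, 2 * m - 1).
Proof.
split=> [/fsetUP[/imfsetP[i /=]|/fset1P ->]|[[i im ->]|->]].
- by rewrite mem_iota => im ->; left; exists i => //; lia.
- by right.
- by apply/fsetUP; left; apply/imfsetP; exists i => //=; rewrite mem_iota; lia.
- by apply/fsetUP; right; apply/fset1P.
Qed.

Lemma top_cycle_diagram m : 3 <= m -> is_diagram m (top_cycle m).
Proof.
move=> m3; apply/is_diagramP; split.
- by move=> c /top_cycleP[[i im ->]|->] /=; lia.
- move=> c d /top_cycleP[[i im ->]|->] /top_cycleP[[j jm ->]|->] /= ij //; try lia.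
  by have -> : i = j by lia.
- move=> c d /top_cycleP[[i im ->]|->] /top_cycleP[[j jm ->]|->] /= ij //; try lia.
  by have -> : i = j by lia.
- by move=> c d /top_cycleP[[i im ->]|->] /top_cycleP[[j jm ->]|->] /= ij; lia.
move=> x xm; have [x2|x2] := boolP ((x == 2) || (x == 2 * m - 1)).
  exists (2, 2 * m - 1); [by apply/top_cycleP; right | by move=> /=; lia].
(* An odd [x] is the source [2i - 1], an even one the sink [2i + 2]. *)
have [xo|xe] := boolP (odd x).
  exists (2 * x.+1./2 - 1, 2 * x.+1./2 + 2); last by left; move=> /=; lia.
  by apply/top_cycleP; left; exists x.+1./2 => //; lia.
exists (2 * (x./2 - 1) - 1, 2 * (x./2 - 1) + 2); last by right; move=> /=; lia.
by apply/top_cycleP; left; exists (x./2 - 1) => //; lia.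
Qed.

(** With [p], [q], [r] in the roles of [(1, 4)], [(2, 2m - 1)], [(3, 6)], the next chords [p'] and
    [q'] satisfy [p'.1 <= q.1 < q'.1 <= r.1 < p.2 < q.2], which is a crossing in [psi T]. *)
Lemma top_cycle_free_psi n T : 0 < n -> is_diagram n T -> staggered n T ->
  noncrossing (psi T) -> top_cycle_free T.
Proof.
move=> n0 Tn Ts nc m S m3 /fsubsetP ST SE; have mem := mem_psi _ n0 Tn Ts.
have chordS c : c \in top_cycle m -> exists2 d, d \in T &
    rank (endpoints S) d.1 = c.1 /\ rank (endpoints S) d.2 = c.2.
  by rewrite -SE => /imfsetP[d /= /ST dT ->]; exists d.
have [|p pT [p1 p2]] := chordS (1, 4).
  by apply/top_cycleP; left; exists 1 => //; lia.
have [|q qT [q1 q2]] := chordS (2, 2 * m - 1); first by apply/top_cycleP; right.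
have [|r rT [r1 _]] := chordS (3, 6).
  by apply/top_cycleP; left; exists 2 => //; lia.
have pq : p.1 < q.1 by apply: (@rank_lt (endpoints S)); rewrite p1 q1.
have qr : q.1 < r.1 by apply: (@rank_lt (endpoints S)); rewrite q1 r1.
have rp : r.1 < p.2 by apply: (@rank_lt (endpoints S)); rewrite p2 r1.
have pq2 : p.2 < q.2 by apply: (@rank_lt (endpoints S)); rewrite p2 q2 /=; lia.
have [p' pp'] := exists_next pT qT pq; have [q' qq'] := exists_next qT rT qr.
have /mem pD : exists c d, consecutive T c d /\ (p'.1 - 1, p.2 - 1) = (d.1 - 1, c.2 - 1).
  by exists p, p'.
have /mem qD : exists c d, consecutive T c d /\ (q'.1 - 1, q.2 - 1) = (d.1 - 1, c.2 - 1).
  by exists q, q'.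
case: pp' qq' => _ _ lt_pp' pmin [_ _ lt_qq' qmin].
have := pmin _ qT pq; have := qmin _ rT qr.
have /negP := nc _ _ pD qD; rewrite /cross /right_neighbor /= => ncr rq' qp'.
by case: ncr; apply/orP; left; clia.
Qed.

(* Follow the chords from [c], each time to the right neighbor with the last source,
   until passing the sink of [d]: since each step skips the sources before the
   previous sink, these chords and [d] form a top cycle. *)
Lemma exists_top_cycle n T c d e : is_diagram n T -> staggered n T ->
  c \in T -> d \in T -> e \in T ->
  [/\ c.1 < d.1, d.1 < e.1, e.1 < c.2 & c.2 < d.2] ->
  ~ top_cycle_free T.
Proof.
move=> Tn Ts cT dT eT [lt_cd lt_de lt_ec lt_cd2] free.
have db := diagram_bound Tn dT.
have [next nextP] : {next : chord -> chord | forall a, a \in T -> a.2 < 2 * n ->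
    [/\ next a \in T, right_neighbor a (next a) &
        forall b, b \in T -> b.1 < a.2 -> b.1 <= (next a).1]}.
  have [|next nextP] := @choice chord chord (fun a b => a \in T -> a.2 < 2 * n ->
    [/\ b \in T, right_neighbor a b & forall b', b' \in T -> b'.1 < a.2 -> b'.1 <= b.1]).
    move=> a; have [/andP[aT an]|an] := boolP ((a \in T) && (a.2 < 2 * n)).
      by have [b bP] := exists_farthest_right_neighbor Tn Ts aT an; exists b.
    by exists a => aT a2; rewrite aT a2 in an.
  by exists next.
pose u k := iter k next c.
(* The sinks of the [u k] strictly increase, so they eventually reach [d.2]. *)
have uP k : (forall i, i < k -> (u i).2 < d.2) -> u k \in T /\ k <= (u k).2.
  elim: k => [//|k IHk] below.
  have [|ukT kuk] := IHk; first by move=> i ik; apply: below; lia.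
  have ukd := below k (ltnSn k).
  have [//||unT /and3P[_ _ lt_u] _] := nextP (u k); first by clia.
  by split=> //; exact: leq_ltn_trans kuk lt_u.
have exK : exists k, d.2 <= (u k).2.
  apply: contrapT => none.
  have below i : (u i).2 < d.2.
    by rewrite ltnNge; apply/negP=> di; apply: none; exists i.
  have [_ ud] := uP d.2 (fun i _ => below i).
  by have := below d.2; rewrite ltnNge ud.
case: (ex_minnP exK) => K dK Kmin.
have below k : k < K -> (u k).2 < d.2.
  by move=> kK; rewrite ltnNge; apply: contraL kK => /Kmin; rewrite -leqNgt.
have K0 : 0 < K by case: K dK {Kmin below} => //; rewrite leqNgt lt_cd2.
have uT k : k <= K -> u k \in T.
  by move=> kK; have [|//] := uP k; move=> i ik; apply: below; lia.
have rn k : k < K -> right_neighbor (u k) (u k.+1).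
  move=> kK; have [||//] := nextP (u k); first by apply: uT; lia.
  by have := below k kK; clia.
have far k a : k < K -> a \in T -> a.1 < (u k).2 -> a.1 <= (u k.+1).1.
  move=> kK aT ak; have [||_ _] := nextP (u k).
  - by apply: uT; lia.
  - by have := below k kK; clia.
  - by apply.
(* The first step reaches at least [e], which starts after [d]. *)
have du k : k < K -> d.1 < (u k.+1).1.
  elim: k => [_|k IHk kK]; first exact: leq_trans (far 0 e K0 eT lt_ec).
  by have /and3P[lt_u _ _] := rn k.+1 kK; apply: ltn_trans lt_u; apply: IHk; lia.
(* Otherwise [u k.+2] would start inside [u k] and later than [u k.+1], against the choice of
   [u k.+1]. *)
have skip k : k.+1 < K -> (u k).2 < (u k.+2).1.
  move=> kK; have /and3P[lt_u _ _] := rn k.+1 kK.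
  have ukT : u k \in T by apply: uT; lia.
  have ukkT : u k.+2 \in T by apply: uT; lia.
  case: (ltngtP (u k).2 (u k.+2).1) => // [lt_ku|E].
    by have := far k _ (ltnW kK) ukkT lt_ku; rewrite leqNgt lt_u.
  by case: (diagram_source_neq_sink Tn ukkT ukT).
(* Equality would force [u K = d], but [u K] starts after [d]. *)
have lt_dK : d.2 < (u K).2.
  have := dK; rewrite leq_eqVlt => /orP[/eqP dKE|//].
  have E := diagram_sink_inj Tn dT (uT K (leqnn K)) dKE.
  by have := du K.-1; rewrite prednK // -E ltnn => /(_ (leqnn K)).
(* Embeds the positions of the top cycle of size [m = K + 2]: its top chord [(2, 2m - 1)] goes to
   [d], and [(2q + 1, 2q + 4)] to [u q] for [q <= K]. *)
pose f x := if x == 2 then d.1 else if x == 2 * K + 3 then d.2 else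
  if odd x then (u x./2).1 else (u (x./2 - 2)).2.
have f_last : f (2 * K + 3) = d.2 by rewrite /f ifF ?eqxx //; lia.
have f_odd q : q <= K -> f (2 * q + 1) = (u q).1.
  move=> qK; rewrite /f ifF; last by lia.
  rewrite ifF; last by lia.
  by rewrite ifT; [congr (u _).1; lia | lia].
have f_even q : q <= K -> f (2 * q + 4) = (u q).2.
  move=> qK; rewrite /f ifF; last by lia.
  rewrite ifF; last by lia.
  by rewrite ifF; [congr (u _).2; lia | lia].
(* The successive gaps are [c.1 < d.1], then [du], [rn] and [skip] along the chain, and [below] and
   [lt_dK] around [d.2]. *)
have f_step x : 1 <= x < 2 * (K + 2) -> f x < f x.+1.
  move=> xK; have [xo|xe] := boolP (odd x).
    have [q xq] : exists q, x = 2 * q + 1 by exists x./2; lia.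
    have [qK|Kq] := leqP q K; last first.
      have -> : x = 2 * K + 3 by lia.
      have -> : (2 * K + 3).+1 = 2 * K + 4 by lia.
      by rewrite f_last f_even.
    rewrite {1}xq f_odd //; case: q xq qK => [->//|q xq qK].
    have -> : x.+1 = 2 * q + 4 by lia.
    by rewrite f_even ?(ltnW qK) //; case/and3P: (rn q qK).
  have [x2|x2] := eqVneq x 2.
    by rewrite x2 (_ : 3 = 2 * 1 + 1) // f_odd //; exact: du.
  have [q xq] : exists q, x = 2 * q + 4 by exists (x./2 - 2); lia.
  rewrite {1}xq f_even; last by lia.
  have [qK|Kq] := ltnP q.+1 K.
    by rewrite (_ : x.+1 = 2 * q.+2 + 1) ?f_odd //; [exact: skip | lia].
  by rewrite (_ : x.+1 = 2 * K + 3) ?f_last; [apply: below; lia | lia].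
have f_mono x y : 1 <= x -> x < y -> y <= 2 * (K + 2) -> f x < f y.
  move=> x1; elim: y => [//|y IHy] xy yK.
  have [->|neq] := eqVneq x y; first by apply: f_step; lia.
  apply: (@ltn_trans (f y)); first by apply: IHy; lia.
  by apply: f_step; lia.
have m3 : 3 <= K + 2 by lia.
apply: (free (K + 2) [fset (f a.1, f a.2) | a in top_cycle (K + 2)] m3); last first.
  exact: relabel_increasing (top_cycle_diagram m3) f_mono.
apply/fsubsetP=> _ /imfsetP[a /= /top_cycleP[[i iK ->]|->] ->] /=.
  rewrite (_ : 2 * i - 1 = 2 * i.-1 + 1); last by lia.
  rewrite (_ : 2 * i + 2 = 2 * i.-1 + 4); last by lia.
  rewrite f_odd; last by lia.
  rewrite f_even; last by lia.
  by rewrite -surjective_pairing; apply: uT; lia.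
rewrite (_ : 2 * (K + 2) - 1 = 2 * K + 3); last by lia.
by rewrite f_last -surjective_pairing.
Qed.

(** A right neighbor pair in [psi T] yields [c.1 < c'.1 <= d.1 < d'.1 < c.2 < d.2], so [d'] serves
    as the third chord for a top cycle. *)
Lemma psi_noncrossing n T : 0 < n -> is_diagram n T -> staggered n T ->
  top_cycle_free T -> noncrossing (psi T).
Proof.
move=> n0 Tn Ts free; have mem := mem_psi _ n0 Tn Ts.
suff no_right_neighbor x y : x \in psi T -> y \in psi T -> ~~ right_neighbor x y.
  by move=> x y xD yD; rewrite negb_or !no_right_neighbor.
move=> /mem[c [c' [[cT c'T lt_cc' cmin] ->]]] /mem[d [d' [[dT d'T lt_dd' dmin] ->]]].
apply/negP=> /and3P[/= c'd' d'c cd2].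
apply: (exists_top_cycle Tn Ts cT dT d'T _ free).
have c'd : c'.1 <= d.1.
  by rewrite leqNgt; apply/negP=> dc'; have := dmin _ c'T dc'; lia.
by split; lia.
Qed.

End ChordDiagrams.

(** * The bijection between the two classes *)

Local Open Scope classical_set_scope.

Theorem proposition8p5 (n : nat) (hn : 2 <= n) :
  set_bij
    [set T : {fset chord} | [/\ is_diagram n T, one_terminal T & top_cycle_free T]]
    [set D : {fset chord} | is_diagram (n - 1) D /\ noncrossing D]
    psi.
Proof.
have n0 : 0 < n by lia.
split.
- move=> T /= [Tn /(one_terminalP Tn) Ts free].
  by split; [exact: psi_diagram | exact: psi_noncrossing Ts free].
- move=> T T' /set_mem /= [Tn /(one_terminalP Tn) Ts _].
  move=> /set_mem /= [T'n /(one_terminalP T'n) T's _].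
  by move=> TT'; rewrite -(psiK n0 Tn Ts) TT' psiK.
(* The preimage [psi_inv n D] is top-cycle-free because its image under [psi] is the noncrossing
   [D]. *)
- move=> D /= [Dn nc]; exists (psi_inv n D); last exact: psi_invK.
  have Tn := psi_inv_diagram n0 Dn; have Ts := psi_inv_staggered n0 Dn.
  split=> //; first exact/(one_terminalP Tn).
  by apply: (top_cycle_free_psi n0 Tn Ts); rewrite psi_invK.
Qed.
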